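(* Consider the linear time-periodic problem $\mathbf u'(t)=A(t)\mathbf u(t)+\mathbf g(t)$, $t\in[0,T]$, $\mathbf u(0)=\mathbf u(T)$, where $A(t)\in\mathbb R^{d\times d}$ and $\mathbf g(t)\in\mathbb R^d$ are $T$-periodic. Assume that the fine and coarse propagators $\mathcal F_n,\mathcal G_n:\mathbb R^d\to\mathbb R^d$ ($0\le n<N$) are affine, with linear parts $F_n$ and $G_n$, and that the fine--coarse discrepancy $\mathcal D_n=\mathcal F_n-\mathcal G_n$ satisfies, for a constant $C_D>0$ independent of $n$ and $\Delta T$, $$\|\mathcal D_n(\mathbf x)-\mathcal D_n(\mathbf y)\|_2\le C_D(\Delta T)^{p+1}\|\mathbf x-\mathbf y\|_2,\qquad \mathbf x,\mathbf y\in\mathbb R^d,\ n=0,\ldots,N-1,$$ where $\Delta T$ is the coarse time interval length and $p$ is the order of the coarse propagator. At iteration $k$, let $\mathcal I^k\subset\{0,\ldots,N-1\}$ be the selected temporal mode set and let $P_{\mathcal I^k}$ be the orthogonal projection of $\mathbb R^d$ onto the mixed Fourier space $\mathcal V_{\rm mix}^k(\mathcal I^k)$. Suppose the linearized cyclic operator $\widehat{\mathcal C}_{P_{\mathcal I^k}}$, i.e. the block-cyclic matrix with diagonal blocks $I$ and cyclic subdiagonal blocks $-(F_nP_{\mathcal I^k}+G_n(I-P_{\mathcal I^k}))$, is invertible, and set $\Gamma_k:=\|\widehat{\mathcal C}_{P_{\mathcal I^k}}^{-1}\|_{\infty\to\infty}$. Let $\mathbf U^{k+1}\in(\mathbb R^d)^N$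 be given by the Fourier-aware projection-based PP-PC update $$\mathbf U_{n+1}^{k+1}=\mathcal F_n(\mathbf U_n^k)+\mathcal H_{P_{\mathcal I^k},n}(\mathbf U_n^{k+1})-\mathcal H_{P_{\mathcal I^k},n}(\mathbf U_n^k),\qquad n=0,\ldots,N-1,\qquad \mathbf U_N^{k+1}=\mathbf U_0^{k+1}.$$ Then $$E_\infty^{k+1}\le\frac{\Gamma_k\,C_D(\Delta T)^{p+1}}{\sqrt N}\left(\operatorname{Tail}_{\mathcal I^k}(\mathbf e^k)+\operatorname{Leak}_{\mathcal I^k}^{P_{\mathcal I^k}}(\mathbf e^k)\right).$$
   Context: Setting. $T>0$, $N$ is a positive integer, $\Delta T=T/N$, $T_n=n\Delta T$; $A$ and $\mathbf g$ are continuous. For $0\le n<N$, $\mathcal F_n(\mathbf x)$ (resp. $\mathcal G_n(\mathbf x)$) is an accurate (resp. less accurate but cheaper) approximation at time $T_{n+1}$ of the solution of the evolution problem starting from $\mathbf x$ at time $T_n$. $I$ is the identity on $\mathbb R^d$. Histories are elements $\mathbf w=(\mathbf w_0,\ldots,\mathbf w_{N-1})\in(\mathbb R^d)^N$; history indices are taken modulo $N$ (so $\mathbf w_N=\mathbf w_0$). Norms: $\|\mathbf w\|_\infty:=\max_{0\le n<N}\|\mathbf w_n\|_2$, and $\|S\|_{\infty\to\infty}:=\sup_{\mathbf w\ne 0}\|S\mathbf w\|_\infty/\|\mathbf w\|_\infty$. Discrepancy-form propagator for an orthogonal projection $P$: $\mathcal H_{P,n}(\mathbf x):=\mathcal G_n(\mathbf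 x)+\mathcal D_n(P\mathbf x)$. Rowwise, $(\widehat{\mathcal C}_P\mathbf w)_{n+1}=\mathbf w_{n+1}-(F_nP+G_n(I-P))\mathbf w_n$, $n=0,\ldots,N-1$, indices modulo $N$. Fine periodic reference: $\mathbf u^\star=(\mathbf u_0^\star,\ldots,\mathbf u_{N-1}^\star)\in(\mathbb R^d)^N$ satisfying $\mathbf u_{n+1}^\star=\mathcal F_n(\mathbf u_n^\star)$ for $n=0,\ldots,N-1$, with $\mathbf u_N^\star=\mathbf u_0^\star$; its existence is assumed. Iterates and errors: $\mathbf U^0,\ldots,\mathbf U^k\in(\mathbb R^d)^N$ are the iterates (interface values) of the Fourier-aware update, from the initial interface values $\mathbf U^0$ through iteration $k$. $\mathbf e_n^j:=\mathbf u_n^\star-\mathbf U_n^j$, $\mathbf e^j:=(\mathbf e_0^j,\ldots,\mathbf e_{N-1}^j)$, $E_\infty^j:=\max_{0\le n<N}\|\mathbf e_n^j\|_2$. Temporal Fourier coefficients of a history $\mathbf w$: $\widehat{\mathbf w}_\ell:=\frac1{\sqrt N}\sum_{n=0}^{N-1}\mathbf w_n\exp(-2\pi\imath\ell n/N)\in\mathbb C^d$, $\ell=0,\ldots,N-1$, where $\imath$ is the imaginary unit. Selected temporal mode set $\mathcal I^k\subset\{0,\ldots,N-1\}$: chosen at iteration $k$ by one of two rules. Fixed rule: $\mathcal I^k=\mathcal I_{\rm fix}$ for all $k$, for a prescribed $\mathcal I_{\rm fix}\subset\{0,\ldots,N-1\}$. Adaptive rule: $\mathcal I^0=\emptyset$,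 and for $k\ge1$, with $\Delta\mathbf U^k:=\mathbf U^k-\mathbf U^{k-1}$ and $a_\ell^k:=\|\widehat{\Delta\mathbf U}_\ell^k\|_2^2$, $\mathcal I^k$ is the union of the $M$ conjugate groups $\{\ell,(N-\ell)\bmod N\}$ with the largest combined energies $a_\ell^k$, $M$ being a prescribed number. Mixed Fourier space: with the discrepancy histories $\mathbf d_n^m:=\mathcal D_n(\mathbf U_n^m)$, $\mathcal V_{\rm mix}^k(\mathcal I^k):=\mathcal V_{\rm sol}^k(\mathcal I^k)+\mathcal V_{\rm disc}^k(\mathcal I^k)\subset\mathbb R^d$, where $\mathcal V_{\rm sol}^k(\mathcal I^k)$ is the real span of $\{\operatorname{Re}\widehat{\mathbf U}_\ell^m,\operatorname{Im}\widehat{\mathbf U}_\ell^m:\ell\in\mathcal I^k,\ 0\le m\le k\}$ and $\mathcal V_{\rm disc}^k(\mathcal I^k)$ is the real span of $\{\operatorname{Re}\widehat{\mathbf d}_\ell^m,\operatorname{Im}\widehat{\mathbf d}_\ell^m:\ell\in\mathcal I^k,\ 0\le m\le k\}$. Tail and leak: for a history $\mathbf w$, a mode set $\mathcal I$ and an orthogonal projection $P$ (extended complex-linearly to $\mathbb C^d$ by $P(\mathbf a+\imath\mathbf b):=P\mathbf a+\imath P\mathbf b$, with the Euclidean norm on $\mathbb C^d$), $\operatorname{Tail}_{\mathcal I}(\mathbf w):=\sum_{\ell\notin\mathcal I}\|\widehat{\mathbf w}_\ell\|_2$ and $\operatorname{Leak}_{\mathcal I}^P(\mathbf w):=\sum_{\ell\in\mathcal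 I}\|(I-P)\widehat{\mathbf w}_\ell\|_2$. *)

(* Defs.v *)
From mathcomp Require Import all_boot all_order all_algebra.
From mathcomp Require Import complex.
From mathcomp Require Import classical_sets reals topology normedtype trigo.

Set Implicit Arguments.
Unset Strict Implicit.
Unset Printing Implicit Defensive.

Import Order.TTheory GRing.Theory Num.Theory.
Local Open Scope ring_scope.
Local Open Scope complex_scope.

(* A history (w_0, ..., w_{N-1}) in (R^d)^N. Indices modulo N are handled by
   the cyclic successor [ordS] and predecessor [ord_pred] on 'I_N, so that the
   row "n + 1" is [ordS n] and the closing condition w_N = w_0 is built in. *)
Notation history R d N := {ffun 'I_N -> 'cV[R]_d}.

Notation propagator R d N := ('I_N -> 'cV[R]_d -> 'cV[R]_d).

(* The norm of the canonical instance on 'cV[R]_d is the max norm, hence the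
   explicit Euclidean norms on R^d and C^d. *)
Definition norm2 (R : realType) (d : nat) (x : 'cV[R]_d) : R :=
  Num.sqrt (\sum_(i < d) x i 0 ^+ 2).

Definition cnorm2 (R : realType) (d : nat) (z : 'cV[R[i]]_d) : R :=
  Num.sqrt (\sum_(i < d) Normc.normc (z i 0) ^+ 2).

Definition norm_inf (R : realType) (d N : nat) (w : history R d N) : R :=
  \big[Num.max/0]_(n < N) norm2 (w n).

Definition op_norm_inf (R : realType) (d N : nat)
    (S : history R d N -> history R d N) : R :=
  sup [set norm_inf (S w) / norm_inf w | w in [set w | w != 0]]%classic.

Definition affine_with_linear_part (R : realType) (d : nat)
    (f : 'cV[R]_d -> 'cV[R]_d) (L : 'M[R]_d) : Prop :=
  exists b : 'cV[R]_d, forall x, f x = L *m x + b.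

Definition discrepancy (R : realType) (d N : nat) (F G : propagator R d N) :
    propagator R d N :=
  fun n x => F n x - G n x.

Definition disc_propagator (R : realType) (d N : nat) (F G : propagator R d N)
    (P : 'M[R]_d) : propagator R d N :=
  fun n x => G n x + discrepancy F G n (P *m x).

Definition update_step (R : realType) (d N : nat) (F G : propagator R d N)
    (P : 'M[R]_d) (U V : history R d N) : Prop :=
  forall n : 'I_N,
    V (ordS n) = F n (U n) + disc_propagator F G P n (V n)
                 - disc_propagator F G P n (U n).

(* Block-cyclic operator with diagonal blocks I and cyclic subdiagonal blocks
   -(F_n P + G_n (I - P)); here Fl n and Gl n are the linear parts, and the
   row n has its subdiagonal block in column n - 1 modulo N. *)
Definition cyclic_op (R : realType) (d N : nat) (Fl Gl : 'I_N -> 'M[R]_d)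
    (P : 'M[R]_d) (w : history R d N) : history R d N :=
  [ffun n => w n - (Fl (ord_pred n) *m P + Gl (ord_pred n) *m (1%:M - P))
                   *m w (ord_pred n)].

Definition fine_periodic (R : realType) (d N : nat) (F : propagator R d N)
    (u : history R d N) : Prop :=
  forall n : 'I_N, u (ordS n) = F n (u n).

(* exp(i t), in Euler form: the libraries have no complex exponential. *)
Definition cis (R : realType) (t : R) : R[i] := cos t +i* sin t.

Definition fourier (R : realType) (d N : nat) (w : history R d N) (l : 'I_N) :
    'cV[R[i]]_d :=
  ((Num.sqrt N%:R)^-1)%:C *:
    \sum_(n < N) cis (- (2 * pi * l%:R * n%:R / N%:R))
                 *: map_mx (real_complex R) (w n).

Definition cRe (R : realType) (d : nat) (z : 'cV[R[i]]_d) : 'cV[R]_d :=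
  map_mx (@complex.Re R) z.

Definition cIm (R : realType) (d : nat) (z : 'cV[R[i]]_d) : 'cV[R]_d :=
  map_mx (@complex.Im R) z.

Lemma conj_mode_subproof (N : nat) (l : 'I_N) : ((N - l) %% N < N)%N.
Proof. by rewrite ltn_pmod // (leq_ltn_trans _ (ltn_ord l)). Qed.

Definition conj_mode (N : nat) (l : 'I_N) : 'I_N :=
  Ordinal (conj_mode_subproof l).

Definition conj_groups (N : nat) : {set {set 'I_N}} :=
  [set [set l; conj_mode l]%SET | l : 'I_N]%SET.

Definition mode_energy (R : realType) (d N : nat) (w : history R d N)
    (l : 'I_N) : R :=
  cnorm2 (fourier w l) ^+ 2.

Definition group_energy (R : realType) (d N : nat) (w : history R d N)
    (g : {set 'I_N}) : R :=
  \sum_(l in g) mode_energy w l.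

(* J is the union of M conjugate groups of largest combined energy; the choice
   among groups of equal energy is left free. *)
Definition top_energy_modes (R : realType) (d N : nat) (M : nat)
    (w : history R d N) (J : {set 'I_N}) : Prop :=
  exists S : {set {set 'I_N}},
    [/\ S \subset conj_groups N, #|S| = M,
        forall g h : {set 'I_N}, g \in S -> h \in conj_groups N :\: S ->
          group_energy w h <= group_energy w g
      & J = finset.cover S].

Definition fixed_rule (N : nat) (J : nat -> {set 'I_N}) (k : nat) : Prop :=
  exists Jfix : {set 'I_N}, forall j, (j <= k)%N -> J j = Jfix.

Definition adaptive_rule (R : realType) (d N : nat) (M : nat)
    (U : nat -> history R d N) (J : nat -> {set 'I_N}) (k : nat) : Prop :=
  J 0%N = finset.set0 /\
  forall j, (1 <= j <= k)%N -> top_energy_modes M (U j - U j.-1) (J j).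

Definition disc_history (R : realType) (d N : nat) (F G : propagator R d N)
    (w : history R d N) : history R d N :=
  [ffun n => discrepancy F G n (w n)].

Definition fourier_span (R : realType) (d N : nat) (W : nat -> history R d N)
    (k : nat) (J : {set 'I_N}) : {vspace 'cV[R]_d} :=
  <<[seq cRe (fourier (W m) l) | m <- iota 0 k.+1, l <- enum J] ++
    [seq cIm (fourier (W m) l) | m <- iota 0 k.+1, l <- enum J]>>%VS.

Definition mixed_space (R : realType) (d N : nat) (F G : propagator R d N)
    (U : nat -> history R d N) (k : nat) (J : {set 'I_N}) :
    {vspace 'cV[R]_d} :=
  (fourier_span U k J + fourier_span (fun m => disc_history F G (U m)) k J)%VS.

Definition orthogonal_projection_onto (R : realType) (d : nat)
    (V : {vspace 'cV[R]_d}) (P : 'M[R]_d) : Prop :=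
  forall x : 'cV[R]_d,
    P *m x \in V /\ forall v, v \in V -> \sum_(i < d) (x - P *m x) i 0 * v i 0 = 0.

Definition complex_ext (R : realType) (d : nat) (P : 'M[R]_d)
    (z : 'cV[R[i]]_d) : 'cV[R[i]]_d :=
  map_mx (real_complex R) (P *m cRe z)
  + 'i%C *: map_mx (real_complex R) (P *m cIm z).

Definition Tail (R : realType) (d N : nat) (J : {set 'I_N})
    (w : history R d N) : R :=
  \sum_(l | l \notin J) cnorm2 (fourier w l).

Definition Leak (R : realType) (d N : nat) (J : {set 'I_N}) (P : 'M[R]_d)
    (w : history R d N) : R :=
  \sum_(l in J) cnorm2 (fourier w l - complex_ext P (fourier w l)).

(* Main.v *)
Require Import Defs.
From HB Require Import structures.
From mathcomp Require Import all_boot all_order all_algebra.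
From mathcomp Require Import complex ring lra.
From mathcomp Require Import boolp classical_sets reals topology normedtype trigo.

(** Let e = u - U^k be the old error and e' = u - U^(k+1) the new one.
    Subtracting the update from the periodicity of the reference, the affine
    constants cancel and
      e'_(n+1) - (F_n P + G_n (1 - P)) e'_n = (F_n - G_n) (1 - P) e_n,
    that is, C_P e' = r with r built from (1 - P) e alone ([cyclic_op_error]):
    the propagator H_P already contains the discrepancy on the range of P, so
    that only its action on the complement is missed.  Hence
    e' = C_P^-1 r, and the Lipschitz bound on the discrepancy, read on its
    linear part, gives
      |e'|_oo <= Gamma_k C_D (Delta T)^(p+1) max_n |(1 - P) e_n|_2.

    Inverting the discrete Fourier transform, (1 - P) e_n is N^(-1/2) times a
    sum over the modes l of unimodular multiples of (1 - P) applied to the l-th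
    Fourier coefficient.  For a selected mode this is a term of the leak; for
    the other modes 1 - P, being an orthogonal projection, does not increase the
    norm, and what is left is a term of the tail
    ([projection_compl_le_tail_leak]).

    Because [e_n] is real, one may take real parts in this sum before estimating
    it, so the triangle inequality is used for real vectors only.

    The operator norm is a supremum, which bounds |S w| / |w| only if these
    quotients are bounded.  This is where the linearity of C_P^-1 and the finite
    dimension enter ([linear_norm_inf_bounded], [norm_inf_op_le]). *)

Import Order.TTheory GRing.Theory Num.Theory numFieldNormedType.Exports.
Local Open Scope ring_scope.

Set Implicit Arguments.
Unset Strict Implicit.
Unset Printing Implicit Defensive.

(** * The Euclidean norm on real vectors *)

Section EuclideanNorm.
Context (R : realType) (d : nat).
Implicit Types x y : 'cV[R]_d.

Lemma norm2_ge0 x : 0 <= norm2 x.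
Proof. exact: sqrtr_ge0. Qed.

Lemma sqr_norm2 x : norm2 x ^+ 2 = \sum_(i < d) x i 0 ^+ 2.
Proof. by rewrite sqr_sqrtr // sumr_ge0 // => i _; rewrite sqr_ge0. Qed.

Lemma norm_coord_le x i : `|x i 0| <= norm2 x.
Proof.
rewrite -sqrtr_sqr ler_wsqrtr // (bigD1 i) //= lerDl.
by rewrite sumr_ge0 // => j _; rewrite sqr_ge0.
Qed.

Lemma norm2_eq0 x : (norm2 x == 0) = (x == 0).
Proof.
apply/eqP/eqP => [x0|->]; last first.
  by rewrite /norm2 big1 ?sqrtr0 // => i _; rewrite mxE expr0n.
apply/colP => i; rewrite mxE; apply/eqP.
by rewrite -normr_le0 -x0 norm_coord_le.
Qed.

Lemma norm20 : norm2 (0 : 'cV[R]_d) = 0.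
Proof. by apply/eqP; rewrite norm2_eq0. Qed.

Lemma norm2Z a x : norm2 (a *: x) = `|a| * norm2 x.
Proof.
rewrite -sqrtr_sqr -sqrtrM ?sqr_ge0 // mulr_sumr.
by congr Num.sqrt; apply: eq_bigr => i _; rewrite mxE exprMn.
Qed.

(** For nonzero x and y, expand
    0 <= sum_i (|y| x_i - |x| y_i)^2 = 2 |x| |y| (|x| |y| - <x, y>)
    and divide by 2 |x| |y|. *)
Lemma cauchy_schwarz_norm2 x y :
  \sum_(i < d) x i 0 * y i 0 <= norm2 x * norm2 y.
Proof.
have [->|x0] := eqVneq x 0.
  by rewrite norm20 mul0r big1 // => i _; rewrite mxE mul0r.
have [->|y0] := eqVneq y 0.
  by rewrite norm20 mulr0 big1 // => i _; rewrite mxE mulr0.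
have xy0 : 0 < norm2 x * norm2 y.
  by rewrite mulr_gt0 // lt_neqAle eq_sym norm2_eq0 ?x0 ?y0 norm2_ge0.
have : 0 <= \sum_(i < d) (norm2 y * x i 0 - norm2 x * y i 0) ^+ 2.
  by rewrite sumr_ge0 // => i _; rewrite sqr_ge0.
have -> : \sum_(i < d) (norm2 y * x i 0 - norm2 x * y i 0) ^+ 2 =
    norm2 y ^+ 2 * \sum_(i < d) x i 0 ^+ 2
    + norm2 x ^+ 2 * \sum_(i < d) y i 0 ^+ 2
    - 2 * (norm2 x * norm2 y) * \sum_(i < d) x i 0 * y i 0.
  rewrite !mulr_sumr -big_split /= -sumrB.
  by apply: eq_bigr => i _; ring.
rewrite -!sqr_norm2 => h.
rewrite -(ler_pM2l xy0); nra.
Qed.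

Lemma ler_norm2D x y : norm2 (x + y) <= norm2 x + norm2 y.
Proof.
rewrite -ler_sqr ?nnegrE ?addr_ge0 ?norm2_ge0 // sqr_norm2.
have -> : \sum_(i < d) (x + y) i 0 ^+ 2 =
    norm2 x ^+ 2 + norm2 y ^+ 2 + 2 * \sum_(i < d) x i 0 * y i 0.
  rewrite !sqr_norm2 mulr_sumr -!big_split /=.
  by apply: eq_bigr => i _; rewrite mxE; ring.
have := cauchy_schwarz_norm2 x y; lra.
Qed.

Lemma ler_norm2_sum (I : Type) (s : seq I) (Q : pred I) (f : I -> 'cV[R]_d) :
  norm2 (\sum_(i <- s | Q i) f i) <= \sum_(i <- s | Q i) norm2 (f i).
Proof.
elim/big_rec2: _ => [|i a x _ le_xa]; first by rewrite norm20.
by rewrite (le_trans (ler_norm2D _ _)) // lerD2l.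
Qed.

(** Pythagoras: [x] splits orthogonally as [P x + (x - P x)]. *)
Lemma orthogonal_projection_compl_le (V : {vspace 'cV[R]_d}) (P : 'M[R]_d) x :
  orthogonal_projection_onto V P -> norm2 (x - P *m x) <= norm2 x.
Proof.
move=> /(_ x)[PxV /(_ _ PxV) orth].
rewrite -ler_sqr ?nnegrE ?norm2_ge0 // [leRHS]sqr_norm2.
have -> : \sum_(i < d) x i 0 ^+ 2 = norm2 (x - P *m x) ^+ 2
    + norm2 (P *m x) ^+ 2
    + 2 * \sum_(i < d) (x - P *m x) i 0 * (P *m x) i 0.
  rewrite !sqr_norm2 mulr_sumr -!big_split /=.
  apply: eq_bigr => i _; move: (P *m x) => y.
  by rewrite !mxE; ring.
by rewrite orth mulr0 addr0 lerDl sqr_ge0.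
Qed.

End EuclideanNorm.

(** * Complex vectors and their real parts *)

Section ComplexVectors.
Context (R : realType) (d : nat).
Implicit Types z : 'cV[R[i]]_d.

Lemma cReD z1 z2 : cRe (z1 + z2) = cRe z1 + cRe z2.
Proof. by apply/colP => i; rewrite !mxE; case: (z1 i 0) (z2 i 0) => ? ? []. Qed.

Lemma cRe0 : cRe (0 : 'cV[R[i]]_d) = 0.
Proof. by apply/colP => i; rewrite !mxE. Qed.

Lemma cReZ (a : R) z : cRe (real_complex R a *: z) = a *: cRe z.
Proof. by apply/colP => i; rewrite !mxE; case: (z i 0) => b c /=; ring. Qed.

Lemma cRe_real (x : 'cV[R]_d) : cRe (map_mx (real_complex R) x) = x.
Proof. by apply/colP => i; rewrite !mxE. Qed.

Lemma sqr_cnorm2 z : cnorm2 z ^+ 2 = norm2 (cRe z) ^+ 2 + norm2 (cIm z) ^+ 2.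
Proof.
rewrite sqr_sqrtr; last by apply: sumr_ge0 => i _; rewrite sqr_ge0.
rewrite !sqr_norm2 -big_split; apply: eq_bigr => i _.
by rewrite !mxE; case: (z i 0) => a b /=; rewrite sqr_sqrtr // addr_ge0 ?sqr_ge0.
Qed.

Lemma cnorm2_ge0 z : 0 <= cnorm2 z.
Proof. exact: sqrtr_ge0. Qed.

Lemma norm2_cRe_le z : norm2 (cRe z) <= cnorm2 z.
Proof.
by rewrite -ler_sqr ?nnegrE ?norm2_ge0 ?cnorm2_ge0 // sqr_cnorm2 lerDl sqr_ge0.
Qed.

Lemma cnorm2_cis t z : cnorm2 (cis t *: z) = cnorm2 z.
Proof.
congr Num.sqrt; apply: eq_bigr => i _; rewrite mxE.
case: (z i 0) => a b /=; congr (Num.sqrt _ ^+ 2).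
rewrite -[RHS]mul1r -(cos2Dsin2 t); ring.
Qed.

Lemma complex_extE (P : 'M[R]_d) z :
  complex_ext P z = map_mx (real_complex R) P *m z.
Proof.
rewrite /complex_ext !map_mxM scalemxAr -mulmxDr; congr (_ *m _).
by apply/colP => i; rewrite !mxE -complexE.
Qed.

Lemma cnorm2_projection_compl_le (V : {vspace 'cV[R]_d}) (P : 'M[R]_d) z :
  orthogonal_projection_onto V P -> cnorm2 (z - complex_ext P z) <= cnorm2 z.
Proof.
move=> projP; rewrite -ler_sqr ?nnegrE ?cnorm2_ge0 // !sqr_cnorm2.
have -> : cRe (z - complex_ext P z) = cRe z - P *m cRe z.
  apply/colP => i; rewrite !(mxE, ffunE) /=; case: (z i 0) => a b /=; ring.
have -> : cIm (z - complex_ext P z) = cIm z - P *m cIm z.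
  apply/colP => i; rewrite !(mxE, ffunE) /=; case: (z i 0) => a b /=; ring.
by rewrite lerD // ler_sqr ?nnegrE ?norm2_ge0 //;
  apply: orthogonal_projection_compl_le projP.
Qed.

End ComplexVectors.

(** * Fourier inversion and the tail-leak estimate *)

Section Fourier.
Context (R : realType).

Lemma cisD (a b : R) : cis (a + b) = cis a * cis b.
Proof.
by rewrite /cis sinD cosD; apply/eqP; rewrite eq_complex /= addrC eqxx addrC eqxx.
Qed.

Lemma cis0 : cis (0 : R) = 1.
Proof. by rewrite /cis cos0 sin0. Qed.

Lemma cis_mulrn (a : R) n : cis (a *+ n) = cis a ^+ n.
Proof.
elim: n => [|n IHn]; first by rewrite mulr0n cis0 expr0.
by rewrite mulrS cisD IHn exprS.
Qed.

Lemma cis_2pi_mulrn n : cis ((2 * pi : R) *+ n) = 1.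
Proof.
by rewrite cis_mulrn /cis mulr_natl cos2pi sin2pi expr1n.
Qed.

(** cos t = 1 - 2 sin (t/2)^2, and sin does not vanish on (0, pi). *)
Lemma cis_neq1 (t : R) : 0 < t < 2 * pi -> cis t != 1.
Proof.
move=> /andP[t0 tpi]; rewrite eq_complex /= negb_and; apply/orP; left.
have : 0 < sin (t / 2) by apply: sin_gt0_pi; lra.
have -> : cos t = 1 - sin (t / 2) ^+ 2 *+ 2.
  have {1}-> : t = (t / 2) *+ 2 by rewrite -mulr_natr; field.
  by rewrite cos_mulr2n cos2sin2; ring.
move=> /gt_eqF s0.
by rewrite -subr_eq0 addrAC subrr sub0r oppr_eq0 mulrn_eq0 sqrf_eq0 s0.
Qed.

Lemma cis_root_neq1 N (i j : 'I_N) :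
  (i < j)%N -> cis (2 * pi * (j%:R - i%:R) / N%:R : R) != 1.
Proof.
move=> ij; apply: cis_neq1.
have N0 : (0 : R) < N%:R by rewrite ltr0n (leq_ltn_trans _ (ltn_ord j)).
have pi2 : (0 : R) < 2 * pi by rewrite mulr_gt0 ?pi_gt0.
have dij : (0 : R) < j%:R - i%:R by rewrite subr_gt0 ltr_nat.
rewrite divr_gt0 ?(mulr_gt0 pi2) //= ltr_pdivrMr // ltr_pM2l // ltrBlDr.
by rewrite (lt_le_trans (_ : j%:R < N%:R)) ?ltr_nat // lerDl ler0n.
Qed.

(** The summands are the powers of cis (2 pi (n - m) / N).  For [m != n] this
    ratio differs from 1 while its N-th power is 1, so the geometric sum
    vanishes. *)
Lemma cis_orthogonality N (m n : 'I_N) :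
  \sum_(l < N) cis (2 * pi * l%:R * n%:R / N%:R)
               * cis (- (2 * pi * l%:R * m%:R / N%:R))
  = (N%:R *+ (m == n) : R[i]).
Proof.
have N0 : (N%:R : R) != 0 by rewrite pnatr_eq0 -lt0n (leq_ltn_trans _ (ltn_ord n)).
pose a : R := 2 * pi * (n%:R - m%:R) / N%:R.
under eq_bigr => l _.
  rewrite -cisD.
  have -> : 2 * pi * l%:R * n%:R / N%:R + - (2 * pi * l%:R * m%:R / N%:R) = a *+ l.
    by rewrite -mulr_natr /a; field.
  rewrite cis_mulrn; over.
have [mn|mn] := eqVneq m n.
  rewrite mulr1n (eq_bigr (fun=> 1)) ?sumr_const ?card_ord // => l _.
  by rewrite /a mn subrr mulr0 mul0r cis0 expr1n.
(* adding 2 pi m keeps the angle a natural multiple of 2 pi, whatever the sign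
   of n - m *)
have aN : cis a ^+ N = 1.
  rewrite -cis_mulrn.
  have e : a *+ N + (2 * pi) *+ m = (2 * pi) *+ n.
    by rewrite -(mulr_natr a) -2!(mulr_natr (2 * pi)) /a; field.
  by have := cis_2pi_mulrn n; rewrite -e cisD cis_2pi_mulrn mulr1.
have a1 : cis a != 1.
  have [lt_mn|lt_nm|/val_inj eq_mn] := ltngtP m n.
  - exact: cis_root_neq1.
  - (* exchanging the two indices inverts the ratio *)
    apply/eqP => a1; have /negP[] := cis_root_neq1 lt_nm.
    have -> : 2 * pi * (m%:R - n%:R) / N%:R = - a by rewrite /a; ring.
    by rewrite -[cis _]mulr1 -{1}a1 -cisD addNr cis0.
  - by rewrite eq_mn eqxx in mn.
rewrite mulr0n; apply/eqP.
have /eqP := subrX1 (cis a) N.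
by rewrite aN subrr eq_sym mulf_eq0 subr_eq0 (negPf a1).
Qed.

Lemma fourier_inversion d N (w : history R d N) (n : 'I_N) :
  map_mx (real_complex R) (w n) =
  real_complex R (Num.sqrt N%:R)^-1 *:
    \sum_(l < N) cis (2 * pi * l%:R * n%:R / N%:R) *: fourier w l.
Proof.
have N0 : (0 : R) < N%:R by rewrite ltr0n (leq_ltn_trans _ (ltn_ord n)).
set s := real_complex R _.
have sN : s * s * N%:R = 1.
  rewrite -(rmorph_nat (real_complex R)) -!rmorphM /= -expr2 exprVn.
  by rewrite sqr_sqrtr ?ler0n // mulVf ?gt_eqF.
rewrite /fourier -/s.
under eq_bigr => l _ do rewrite scalerA mulrC -scalerA scaler_sumr.
rewrite -scaler_sumr exchange_big /= scalerA.
under eq_bigr => m _.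
  under eq_bigr => l _ do rewrite scalerA.
  rewrite -scaler_suml cis_orthogonality; over.
rewrite (bigD1 n) //= eqxx big1 => [|m /negPf ->]; last first.
  by rewrite mulr0n scale0r.
by rewrite addr0 mulr1n scalerA sN scale1r.
Qed.

(** The real matrix 1 - P commutes with the inverse transform, and multiplication
    by a unimodular factor followed by the real part does not increase the norm.
    The contraction property of 1 - P is used only outside [J]. *)
Lemma projection_compl_le_tail_leak d N (w : history R d N) (J : {set 'I_N})
    (V : {vspace 'cV[R]_d}) (P : 'M[R]_d) (n : 'I_N) :
  orthogonal_projection_onto V P ->
  norm2 (w n - P *m w n) <= (Num.sqrt N%:R)^-1 * (Tail J w + Leak J P w).
Proof.
move=> projP.
have -> : w n - P *m w n = (Num.sqrt N%:R)^-1 *: \sum_(l < N)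
    cRe (cis (2 * pi * l%:R * n%:R / N%:R)
         *: (fourier w l - complex_ext P (fourier w l))).
  rewrite -(big_morph _ (@cReD R d) (@cRe0 R d)) -cReZ.
  rewrite -[LHS]cRe_real map_mxB map_mxM; congr cRe.
  rewrite fourier_inversion -scalemxAr -scalerBr; congr (_ *: _).
  rewrite mulmx_sumr -sumrB; apply: eq_bigr => l _.
  by rewrite complex_extE -scalemxAr scalerBr.
rewrite norm2Z ger0_norm ?invr_ge0 ?sqrtr_ge0 //.
rewrite ler_wpM2l ?invr_ge0 ?sqrtr_ge0 //.
rewrite (le_trans (ler_norm2_sum _ _ _)) //.
rewrite (bigID (mem J)) /= addrC lerD // ler_sum // => l _;
  rewrite (le_trans (norm2_cRe_le _)) // cnorm2_cis //.
exact: cnorm2_projection_compl_le projP.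
Qed.

End Fourier.

(** * The maximum norm on histories and operator norms *)

Section SupNorm.
Context (R : realType) (d N : nat).
Implicit Types v w : history R d N.

Lemma norm_inf_ge0 w : 0 <= norm_inf w.
Proof. exact: bigmax_ge_id. Qed.

Lemma norm2_le_norm_inf w n : norm2 (w n) <= norm_inf w.
Proof. exact: le_bigmax. Qed.

Lemma norm_inf_le w c : 0 <= c -> (forall n, norm2 (w n) <= c) -> norm_inf w <= c.
Proof. by move=> c0 wc; apply: bigmax_le. Qed.

Lemma norm_inf0 : norm_inf (0 : history R d N) = 0.
Proof.
apply/eqP; rewrite eq_le norm_inf_ge0 andbT norm_inf_le // => n.
by rewrite ffunE norm20.
Qed.

Lemma norm_inf_gt0 w : w != 0 -> 0 < norm_inf w.
Proof.
move=> w0; rewrite lt_def norm_inf_ge0 andbT; apply: contra w0 => /eqP w0.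
apply/eqP/ffunP => n; rewrite ffunE; apply/eqP.
by rewrite -norm2_eq0 eq_le norm2_ge0 andbT -w0 norm2_le_norm_inf.
Qed.

Lemma ler_norm_infD v w : norm_inf (v + w) <= norm_inf v + norm_inf w.
Proof.
apply: norm_inf_le => [|n]; first by rewrite addr_ge0 ?norm_inf_ge0.
by rewrite ffunE (le_trans (ler_norm2D _ _)) // lerD ?norm2_le_norm_inf.
Qed.

Lemma ler_norm_infZ a w : norm_inf (a *: w) <= `|a| * norm_inf w.
Proof.
apply: norm_inf_le => [|n]; first by rewrite mulr_ge0 ?norm_inf_ge0.
by rewrite ffunE norm2Z ler_wpM2l ?norm2_le_norm_inf.
Qed.

Lemma ler_norm_inf_sum (I : Type) (s : seq I) (f : I -> history R d N) :
  norm_inf (\sum_(i <- s) f i) <= \sum_(i <- s) norm_inf (f i).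
Proof.
elim/big_rec2: _ => [|i a x _ le_xa]; first by rewrite norm_inf0.
by rewrite (le_trans (ler_norm_infD _ _)) // lerD2l.
Qed.

Definition delta_history (n : 'I_N) (i : 'I_d) : history R d N :=
  [ffun m => (m == n)%:R *: delta_mx i 0].

Lemma history_sum_delta w : w = \sum_n \sum_i w n i 0 *: delta_history n i.
Proof.
apply/ffunP => m; apply/colP => j; rewrite sum_ffunE summxE.
rewrite (bigD1 m) //= sum_ffunE summxE (bigD1 j) //= !ffunE !mxE !eqxx !mulr1.
rewrite !big1 ?addr0 // => [n nm|i ij]; last first.
  by rewrite !ffunE !mxE (eq_sym j) (negPf ij) !mulr0.
rewrite sum_ffunE summxE big1 // => i _.
by rewrite !ffunE !mxE (eq_sym m) (negPf nm) mul0r mulr0.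
Qed.

(** Each coordinate of [w] is bounded by its norm, so the norms of the images of
    the coordinate histories add up to a bound for [S]. *)
Lemma linear_norm_inf_bounded (S : {linear history R d N -> history R d N}) :
  exists B, forall w, norm_inf (S w) <= B * norm_inf w.
Proof.
exists (\sum_n \sum_i norm_inf (S (delta_history n i))) => w.
rewrite {1}[w]history_sum_delta linear_sum mulr_suml.
rewrite (le_trans (ler_norm_inf_sum _ _)) // ler_sum // => n _.
rewrite linear_sum mulr_suml (le_trans (ler_norm_inf_sum _ _)) // ler_sum // => i _.
rewrite linearZ (le_trans (ler_norm_infZ _ _)) // mulrC ler_wpM2l ?norm_inf_ge0 //.
exact: le_trans (norm_coord_le _ _) (norm2_le_norm_inf _ _).
Qed.

Lemma op_norm_inf_ge0 (S : history R d N -> history R d N) : 0 <= op_norm_inf S.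
Proof.
rewrite /op_norm_inf; set E := (X in sup X).
have [[E0 Eub]|noE] := pselect (has_sup E); last by rewrite sup_out.
have [x Ex] := E0; rewrite (le_trans _ (ub_le_sup Eub Ex)) //.
by case: Ex => w _ <-; rewrite divr_ge0 ?norm_inf_ge0.
Qed.

(** Boundedness of [S] makes the supremum in its operator norm an upper bound of
    the quotients; at [w = 0], where there is no quotient, it forces [S 0 = 0]. *)
Lemma norm_inf_op_le (S : history R d N -> history R d N) w :
  linear S -> norm_inf (S w) <= op_norm_inf S * norm_inf w.
Proof.
move=> linS.
pose Slin : {linear history R d N -> history R d N} :=
  HB.pack S (GRing.isLinear.Build R _ _ _ S linS).
have [B SB] : exists B, forall v, norm_inf (S v) <= B * norm_inf v.
  exact: (linear_norm_inf_bounded Slin).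
have [->|w0] := eqVneq w 0.
  by rewrite (le_trans (SB _)) // norm_inf0 !mulr0.
rewrite -ler_pdivrMr ?norm_inf_gt0 //; apply: ub_le_sup; last by exists w.
by exists B => _ [v v0 <-]; rewrite ler_pdivrMr ?norm_inf_gt0.
Qed.

End SupNorm.

(** * The cyclic operator and the error equation *)

Section CyclicOperator.
Context (R : realType) (d N : nat) (Fl Gl : 'I_N -> 'M[R]_d).

Lemma cyclic_op_linear (P : 'M[R]_d) : linear (cyclic_op Fl Gl P).
Proof.
move=> a v w; apply/ffunP => n; rewrite !ffunE.
rewrite [X in _ - X = _]mulmxDr -scalemxAr scalerBr.
by rewrite opprD addrACA.
Qed.

Lemma cyclic_op_inv_linear (P : 'M[R]_d) (Cinv : history R d N -> history R d N) :
  cancel (cyclic_op Fl Gl P) Cinv -> cancel Cinv (cyclic_op Fl Gl P) ->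
  linear Cinv.
Proof.
move=> CK KC.
pose C : {linear history R d N -> history R d N} :=
  HB.pack (cyclic_op Fl Gl P)
    (GRing.isLinear.Build R _ _ _ _ (cyclic_op_linear P)).
exact: (@can2_linear _ _ _ C).
Qed.

Lemma discrepancyB (F G : 'I_N -> 'cV[R]_d -> 'cV[R]_d) n x y :
  (forall m, affine_with_linear_part (F m) (Fl m)) ->
  (forall m, affine_with_linear_part (G m) (Gl m)) ->
  discrepancy F G n x - discrepancy F G n y = (Fl n - Gl n) *m (x - y).
Proof.
move=> /(_ n)[b Fb] /(_ n)[c Gc].
rewrite /discrepancy !Fb !Gc mulmxBl !mulmxBr.
apply/colP => i; rewrite !(mxE, ffunE); ring.
Qed.

(** The reference satisfies
    u_(n+1) = F_n u_n + H_P u_n - H_P u_n, so its difference with the update is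
    driven by F_n u_n - F_n U_n - (H_P u_n - H_P U_n); as F_n = G_n + D_n and H_P
    is G_n plus D_n after P, the coarse parts cancel and D_n is left on
    (1 - P) e_n. *)
Lemma cyclic_op_error (F G : 'I_N -> 'cV[R]_d -> 'cV[R]_d) (P : 'M[R]_d)
    (u U V : history R d N) :
  (forall n, affine_with_linear_part (F n) (Fl n)) ->
  (forall n, affine_with_linear_part (G n) (Gl n)) ->
  fine_periodic F u -> update_step F G P U V ->
  cyclic_op Fl Gl P (u - V) =
  [ffun n => let m := ord_pred n in
     (Fl m - Gl m) *m ((u - U) m - P *m (u - U) m)].
Proof.
move=> F_affine G_affine uF UV; apply/ffunP => n; rewrite !ffunE /=.
set m := ord_pred n.
have -> : (u - U) m = u m - U m by rewrite !ffunE.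
have [b Fb] := F_affine m; have [c Gc] := G_affine m.
rewrite -(ord_predK n) -/m uF UV /disc_propagator /discrepancy !Fb !Gc.
rewrite !(mulmxBl, mulmxBr, mulmxDl, mulmxDr, mulmxA, mulmx1, mulmxN, mulNmx).
(* hiding the matrix products reduces the goal to an identity of sums, which can
   be checked entrywise *)
move: (Fl m *m u m) (Fl m *m U m) (Gl m *m u m) (Gl m *m U m) (Gl m *m V m)
  (Fl m *m P *m u m) (Fl m *m P *m U m) (Fl m *m P *m V m)
  (Gl m *m P *m u m) (Gl m *m P *m U m) (Gl m *m P *m V m).
move=> *; apply/colP => i; rewrite !(mxE, ffunE); ring.
Qed.

End CyclicOperator.

(** * The error bound *)

Theorem corollary4p5 (R : realType) (d : nat) (CD : R) (hCD : 0 < CD) (p : nat)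
  (* linear time-periodic problem u' = A u + g, u(0) = u(T) *)
  (T : R) (hT : 0 < T) (A : R -> 'M[R]_d) (g : R -> 'cV[R]_d)
  (A_cont : continuous A) (g_cont : continuous g)
  (A_per : forall t, A (t + T) = A t) (g_per : forall t, g (t + T) = g t)
  (* affine fine and coarse propagators *)
  (N : nat) (hN : (0 < N)%N) (F G : 'I_N -> 'cV[R]_d -> 'cV[R]_d)
  (Fl Gl : 'I_N -> 'M[R]_d)
  (F_affine : forall n, affine_with_linear_part (F n) (Fl n))
  (G_affine : forall n, affine_with_linear_part (G n) (Gl n))
  (D_lip : forall (n : 'I_N) (x y : 'cV[R]_d),
     norm2 (discrepancy F G n x - discrepancy F G n y)
       <= CD * (T / N%:R) ^+ p.+1 * norm2 (x - y))
  (* fine periodic reference *)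
  (u : history R d N) (u_ref : fine_periodic F u)
  (* iterates U 0, ..., U k.+1, mode sets and projections *)
  (k : nat) (U : nat -> history R d N) (J : nat -> {set 'I_N})
  (P : nat -> 'M[R]_d)
  (J_rule : fixed_rule J k \/ exists M : nat, adaptive_rule M U J k)
  (P_proj : forall j, (j <= k)%N ->
     orthogonal_projection_onto (mixed_space F G U j (J j)) (P j))
  (U_update : forall j, (j <= k)%N -> update_step F G (P j) (U j) (U j.+1))
  (* invertibility of the cyclic operator, with inverse Cinv *)
  (Cinv : history R d N -> history R d N)
  (Cinv_l : cancel (cyclic_op Fl Gl (P k)) Cinv)
  (Cinv_r : cancel Cinv (cyclic_op Fl Gl (P k))) :
  norm_inf (u - U k.+1)
    <= op_norm_inf Cinv * CD * (T / N%:R) ^+ p.+1 / Num.sqrt N%:R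
       * (Tail (J k) (u - U k) + Leak (J k) (P k) (u - U k)).
Proof.
set c := CD * (T / N%:R) ^+ p.+1.
have c0 : 0 <= c by rewrite mulr_ge0 ?(ltW hCD) // exprn_ge0 // divr_ge0 ?ler0n // ltW.
have Dlin n x : norm2 ((Fl n - Gl n) *m x) <= c * norm2 x.
  by have := D_lip n x 0; rewrite (discrepancyB _ _ _ F_affine G_affine) subr0.
have tl0 : 0 <= Tail (J k) (u - U k) + Leak (J k) (P k) (u - U k).
  by rewrite addr_ge0 // sumr_ge0 // => l _; apply: cnorm2_ge0.
rewrite -(Cinv_l (u - U k.+1)) (cyclic_op_error F_affine G_affine u_ref (U_update k (leqnn k))).
rewrite (le_trans (norm_inf_op_le _ (cyclic_op_inv_linear Cinv_l Cinv_r))) //.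
have -> : op_norm_inf Cinv * CD * (T / N%:R) ^+ p.+1 / Num.sqrt N%:R
    * (Tail (J k) (u - U k) + Leak (J k) (P k) (u - U k)) =
    op_norm_inf Cinv * (c * ((Num.sqrt N%:R)^-1
      * (Tail (J k) (u - U k) + Leak (J k) (P k) (u - U k)))).
  by rewrite /c !mulrA.
clearbody c.
rewrite ler_wpM2l ?op_norm_inf_ge0 //.
apply: norm_inf_le => [|n]; first by rewrite (mulr_ge0 c0) // mulr_ge0 ?invr_ge0 ?sqrtr_ge0.
rewrite ffunE (le_trans (Dlin _ _)) // ler_wpM2l //.
exact: projection_compl_le_tail_leak (P_proj k (leqnn k)).
Qed.
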